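(* Let $\tau=\bar a\cup\bar U\cup\bar R$ be a vocabulary consisting of a finite set $\bar a$ of (hard-wired) constant symbols, a finite set $\bar U$ of unary relation symbols, and a finite set $\bar R$ of binary relation symbols. (i) For every class $\mathcal{C}$ of $\tau$-structures there exist a vocabulary $\tau'$ containing only a finite number $r(\bar a,\bar U,\bar R)$ of binary relation symbols (and no other symbols), and finitely many classes $\mathcal{C}_1,\ldots,\mathcal{C}_r$ of $\tau'$-structures, such that for all $n\in\mathbb{N}$ $$Sp_{\mathcal{C}}(n)=\sum_{i=1}^{r}Sp_{\mathcal{C}_i}(n).$$ (This is an equality of integers, not merely a congruence.) (ii) Furthermore, if $\mathcal{C}$ is FOL-definable (respectively MSOL-definable, CMSOL-definable), then so are the classes $\mathcal{C}_i$.
   Context: Notation: $[n]=\{1,\ldots,n\}$; $\ell_{\bar a}$ is the number of constant symbols in $\bar a=\{a_1,\ldots,a_{\ell_{\bar a}}\}$. Counting function with hard-wired constants: constants are hard-wired (hard-coded), i.e. each is always interpreted by the same fixed element. For a class $\mathcal{C}$ of finite structures over a vocabulary with constants $a_1,\ldots,a_{\ell}$ and some relation symbols, $Sp_{\mathcal{C}}(n)$ (also written $f_{\mathcal{C}}(n)$) is the number of structures in $\mathcal{C}$ with universe $[n+\ell]$ in which $a_i$ is interpreted as $n+i$ for every $i\in[\ell]$; that is, one counts the possible interpretations of the relation symbols on $[n+\ell]$ only. When there are no constants ($\ell=0$), this is the number of structures in $\mathcal{C}$ with universe $[n]$. Logics: FOL is first order logic with equality. MSOL (Monadic Second Order Logic)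 extends FOL by unary relation variables and quantification over them. CMSOL extends MSOL by the modular counting quantifiers $\mathrm{C}_{m,r}x\,\phi(x)$, which hold in a structure with universe $A$ iff $|\{b\in A:\phi(b)\}|\equiv r \pmod m$. A class is definable in a logic if it is the class of finite structures satisfying some sentence of that logic over the vocabulary. *)

(* Defs.v *)
From mathcomp Require Import all_boot.
From mathcomp Require Import boolp.

Set Implicit Arguments.
Unset Strict Implicit.
Unset Printing Implicit Defensive.

Record vocabulary := Vocabulary {
  nconst : nat;
  nunary : nat;
  nbinary : nat
}.

Definition binary_vocabulary (r : nat) : vocabulary := Vocabulary 0 0 r.

(* The empty universe is allowed when there are no constants: it is the
   universe [0] counted by Sp at n = 0. *)
Record structure (tau : vocabulary) := Structure {
  universe :> finType;
  const_interp : 'I_(nconst tau) -> universe;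
  unary_interp : {ffun 'I_(nunary tau) -> {set universe}};
  binary_interp : {ffun 'I_(nbinary tau) -> {set universe * universe}}
}.

Definition class (tau : vocabulary) := structure tau -> Prop.

Definition isomorphic tau (M N : structure tau) : Prop :=
  exists f : M -> N,
    [/\ bijective f,
        forall c, f (const_interp M c) = const_interp N c,
        forall u x, (f x \in unary_interp N u) = (x \in unary_interp M u) &
        forall b x y, ((f x, f y) \in binary_interp N b)
                      = ((x, y) \in binary_interp M b)].

Definition iso_closed tau (C : class tau) : Prop :=
  forall M N : structure tau, isomorphic M N -> C M -> C N.

(* The universe [n + l] is 'I_(n + l), shifted down by one; the i-th constant
   (i : 'I_l, also counted from 0) denotes the ordinal n + i. *)
Definition hardwired tau n
    (U : {ffun 'I_(nunary tau) -> {set 'I_(n + nconst tau)}})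
    (R : {ffun 'I_(nbinary tau) ->
            {set 'I_(n + nconst tau) * 'I_(n + nconst tau)}}) :
    structure tau :=
  @Structure tau 'I_(n + nconst tau) (fun i => rshift n i) U R.

Definition Sp tau (C : class tau) (n : nat) : nat :=
  #|[set UR | `[< C (@hardwired tau n UR.1 UR.2) >]]|.

Inductive term (tau : vocabulary) (k : nat) :=
  | Var of 'I_k
  | Const of 'I_(nconst tau).

(* Well-scoped de Bruijn syntax: [formula tau k p] has its free element
   variables in 'I_k and its free set variables in 'I_p; a quantifier binds
   index 0 and shifts the others up. *)
Inductive formula (tau : vocabulary) : nat -> nat -> Type :=
  | FFalse k p : formula tau k p
  | FEq k p of term tau k & term tau k : formula tau k p
  | FUnary k p of 'I_(nunary tau) & term tau k : formula tau k p
  | FBinary k p of 'I_(nbinary tau) & term tau k & term tau k :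
      formula tau k p
  | FMem k p of term tau k & 'I_p : formula tau k p
  | FNot k p of formula tau k p : formula tau k p
  | FAnd k p of formula tau k p & formula tau k p : formula tau k p
  | FOr k p of formula tau k p & formula tau k p : formula tau k p
  | FExists k p of formula tau k.+1 p : formula tau k p
  | FForall k p of formula tau k.+1 p : formula tau k p
  | FExistsSet k p of formula tau k p.+1 : formula tau k p
  | FForallSet k p of formula tau k p.+1 : formula tau k p
  | FCount k p (m r : nat) of 0 < m & formula tau k.+1 p : formula tau k p.

Definition sentence (tau : vocabulary) := formula tau 0 0.

Definition eval tau (M : structure tau) k (e : k.-tuple M) (t : term tau k) :
    M :=
  match t with
  | Var i => tnth e i
  | Const c => const_interp M c
  end.

Fixpoint sat tau (M : structure tau) k p (phi : formula tau k p) :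
    k.-tuple M -> p.-tuple {set M} -> bool :=
  match phi with
  | FFalse _ _ => fun _ _ => false
  | FEq _ _ t1 t2 => fun e _ => eval e t1 == eval e t2
  | FUnary _ _ u t => fun e _ => eval e t \in unary_interp M u
  | FBinary _ _ b t1 t2 => fun e _ =>
      (eval e t1, eval e t2) \in binary_interp M b
  | FMem _ _ t X => fun e s => eval e t \in tnth s X
  | FNot _ _ f => fun e s => ~~ sat f e s
  | FAnd _ _ f g => fun e s => sat f e s && sat g e s
  | FOr _ _ f g => fun e s => sat f e s || sat g e s
  | FExists _ _ f => fun e s => [exists x : M, sat f (cons_tuple x e) s]
  | FForall _ _ f => fun e s => [forall x : M, sat f (cons_tuple x e) s]
  | FExistsSet _ _ f => fun e s =>
      [exists X : {set M}, sat f e (cons_tuple X s)]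
  | FForallSet _ _ f => fun e s =>
      [forall X : {set M}, sat f e (cons_tuple X s)]
  | FCount _ _ m r _ f => fun e s =>
      #|[set x : M | sat f (cons_tuple x e) s]| == r %[mod m]
  end.

Definition models tau (M : structure tau) (phi : sentence tau) : bool :=
  @sat tau M 0 0 phi (nil_tuple M) (nil_tuple {set M}).

Inductive logic := FOL | MSOL | CMSOL.

Definition has_sets (L : logic) : bool :=
  match L with FOL => false | MSOL | CMSOL => true end.

Definition has_counting (L : logic) : bool :=
  match L with FOL | MSOL => false | CMSOL => true end.

Fixpoint in_logic (L : logic) tau k p (phi : formula tau k p) : bool :=
  match phi with
  | FFalse _ _ | FEq _ _ _ _ | FUnary _ _ _ _ | FBinary _ _ _ _ _ => true
  | FMem _ _ _ _ => has_sets L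
  | FNot _ _ f => in_logic L f
  | FAnd _ _ f g | FOr _ _ f g => in_logic L f && in_logic L g
  | FExists _ _ f | FForall _ _ f => in_logic L f
  | FExistsSet _ _ f | FForallSet _ _ f => has_sets L && in_logic L f
  | FCount _ _ _ _ _ f => has_counting L && in_logic L f
  end.

Definition definable (L : logic) tau (C : class tau) : Prop :=
  exists2 phi : sentence tau,
    in_logic L phi & forall M : structure tau, C M <-> models M phi.

(* Main.v *)
(* A structure over [n] plus the constants splits into its restriction to the
   constants, one of finitely many types [k], and its remaining part, which
   consists of binary relations on [n] and of the unary predicates [U(x)],
   [R(x, a)] and [R(a, x)] on [n]. Coding each unary predicate by a subset of the
   diagonal gives, for each [k], a class of purely binary structures in bijection
   with the structures of type [k]. These classes stay definable because a
   quantifier over the old universe amounts to a quantifier over the new one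
   together with a finite case distinction on the constants. *)
Require Import Defs.
From mathcomp Require Import all_boot.
From mathcomp Require Import boolp.

Set Implicit Arguments.
Unset Strict Implicit.
Unset Printing Implicit Defensive.

(** * Finite disjunctions and conjunctions of formulas *)

Section BigConnectives.

Variables (tau : vocabulary) (k p : nat).
Implicit Type L : logic.

Definition FBool (b : bool) : formula tau k p :=
  if b then FNot (FFalse tau k p) else FFalse tau k p.

Definition FBigOr (T : finType) (f : T -> formula tau k p) : formula tau k p :=
  foldr (fun t => @FOr tau k p (f t)) (FFalse tau k p) (enum T).

Definition FBigAnd (T : finType) (f : T -> formula tau k p) : formula tau k p :=
  foldr (fun t => @FAnd tau k p (f t)) (FBool true) (enum T).

Lemma sat_FBool (M : structure tau) b (e : k.-tuple M) (s : p.-tuple {set M}) :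
  sat (FBool b) e s = b.
Proof. by case: b. Qed.

Lemma in_logic_FBool L b : in_logic L (FBool b).
Proof. by case: b. Qed.

Lemma sat_FBigOr (M : structure tau) (T : finType) (f : T -> formula tau k p)
    (e : k.-tuple M) (s : p.-tuple {set M}) :
  sat (FBigOr f) e s = [exists t, sat (f t) e s].
Proof.
have -> : sat (FBigOr f) e s = has (fun t => sat (f t) e s) (enum T).
  by rewrite /FBigOr; elim: (enum T) => //= t ts ->.
apply/hasP/existsP => [[t _ ft]|[t ft]]; first by exists t.
by exists t; rewrite ?mem_enum.
Qed.

Lemma sat_FBigAnd (M : structure tau) (T : finType) (f : T -> formula tau k p)
    (e : k.-tuple M) (s : p.-tuple {set M}) :
  sat (FBigAnd f) e s = [forall t, sat (f t) e s].
Proof.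
have -> : sat (FBigAnd f) e s = all (fun t => sat (f t) e s) (enum T).
  by rewrite /FBigAnd; elim: (enum T) => //= t ts ->.
apply/allP/forallP => [ft t|ft t _]; last exact: ft.
by apply: ft; rewrite mem_enum.
Qed.

Lemma in_logic_FBigOr L (T : finType) (f : T -> formula tau k p) :
  (forall t, in_logic L (f t)) -> in_logic L (FBigOr f).
Proof. by move=> Lf; rewrite /FBigOr; elim: (enum T) => //= t ts ->; rewrite Lf. Qed.

Lemma in_logic_FBigAnd L (T : finType) (f : T -> formula tau k p) :
  (forall t, in_logic L (f t)) -> in_logic L (FBigAnd f).
Proof. by move=> Lf; rewrite /FBigAnd; elim: (enum T) => //= t ts ->; rewrite Lf. Qed.

End BigConnectives.

Definition sum_mapl (A B D : Type) (f : A -> B) (x : A + D) : B + D :=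
  match x with inl a => inl (f a) | inr d => inr d end.

Lemma sum_mapl_can (A B D : Type) (f : A -> B) (g : B -> A) :
  cancel f g -> cancel (@sum_mapl A B D f) (sum_mapl g).
Proof. by move=> fK [a|d] //=; rewrite fK. Qed.

(** Since [m.-1] is [-1] modulo [m], adding [b * m.-1] subtracts [b] without truncated subtraction;
    added to both sides of the right-hand congruence, it turns [a + b] into [a + b * m]. *)
Lemma modn_shift (m a b r : nat) : 0 < m ->
  (a == r + b * m.-1 %[mod m]) = (a + b == r %[mod m]).
Proof.
move=> m_gt0; rewrite -[RHS](eqn_modDr (b * m.-1)) -addnA -mulnS prednK //.
by rewrite [a + _]addnC modnMDl.
Qed.

(** * Constant types and the coding by binary relations *)

Section Reduction.

Variable tau : vocabulary.

Local Notation l := (nconst tau).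

Definition const_type : finType :=
  ({ffun 'I_(nunary tau) -> {set 'I_l}} *
   {ffun 'I_(nbinary tau) -> {set 'I_l * 'I_l}})%type.

(* The unary predicates on the non-constant elements: [U(x)], [R(x, a)] and
   [R(a, x)]. Each is coded by a binary relation contained in the diagonal. *)
Definition unary_sym : finType :=
  ('I_(nunary tau) +
   ('I_(nbinary tau) * 'I_l + 'I_(nbinary tau) * 'I_l))%type.

Definition sym : finType := ('I_(nbinary tau) + unary_sym)%type.

(* Symbols of index below [#|const_type|] are dummies, interpreted by the empty
   relation; they are there because the theorem uses one number for both the
   relation symbols and the classes. *)
Definition nsym : nat := #|const_type| + #|sym|.

Definition code (s : sym) : 'I_nsym := rshift #|const_type| (enum_rank s).

Definition code_unary (u : 'I_(nunary tau)) := code (inr (inl u)).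
Definition code_right (b : 'I_(nbinary tau)) (c : 'I_l) :=
  code (inr (inr (inl (b, c)))).
Definition code_left (b : 'I_(nbinary tau)) (c : 'I_l) :=
  code (inr (inr (inr (b, c)))).

Local Notation tau' := (binary_vocabulary nsym).
Local Notation relations T := {ffun 'I_nsym -> {set T * T}}.

Section Decoding.

Variables (T : finType) (R : relations T) (k : const_type).

Definition decode_unary u (x : T + 'I_l) : bool :=
  match x with
  | inl y => (y, y) \in R (code_unary u)
  | inr c => c \in k.1 u
  end.

Definition decode_binary b (x y : T + 'I_l) : bool :=
  match x, y with
  | inl x, inl y => (x, y) \in R (code (inl b))
  | inl x, inr c => (x, x) \in R (code_right b c)
  | inr c, inl y => (y, y) \in R (code_left b c)
  | inr c, inr d => (c, d) \in k.2 b
  end.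

(** These conditions make decoding injective: [decode] reads neither the dummy symbols nor the
    off-diagonal pairs of a coded unary predicate, so their content has to be fixed. *)
Definition well_coded : bool :=
  [forall j : 'I_#|const_type|, R (lshift #|sym| j) == set0] &&
  [forall s : unary_sym, forall x, forall y,
     ((x, y) \in R (code (inr s))) ==> (x == y)].

(** The map [g] names the non-constant elements. It is a parameter so that it can be either the
    enumeration of an arbitrary universe or a cast between ordinal types. *)
Definition decode n (g : 'I_n -> T) :
    {ffun 'I_(nunary tau) -> {set 'I_(n + l)}} *
    {ffun 'I_(nbinary tau) -> {set 'I_(n + l) * 'I_(n + l)}} :=
  ([ffun u => [set x | decode_unary u (sum_mapl g (split x))]],
   [ffun b => [set z | decode_binary b (sum_mapl g (split z.1))
                                       (sum_mapl g (split z.2))]]).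

End Decoding.

Definition hardwired_pair n
    (UR : {ffun 'I_(nunary tau) -> {set 'I_(n + l)}} *
          {ffun 'I_(nbinary tau) -> {set 'I_(n + l) * 'I_(n + l)}}) :
    structure tau :=
  @hardwired tau n UR.1 UR.2.

(** Decoding up to isomorphism: arguments about isomorphism and satisfaction can use any bijection
    [h] and avoid the arithmetic of the universe ['I_(n + l)]. *)
Record decodes_to (N : structure tau') (k : const_type) (M : structure tau)
    (h : N + 'I_l -> M) : Prop := DecodesTo {
  decodes_bij : bijective h;
  decodes_const : forall c, h (inr c) = const_interp M c;
  decodes_unary : forall u x,
    (h x \in unary_interp M u) = decode_unary (binary_interp N) k u x;
  decodes_binary : forall b x y,
    ((h x, h y) \in binary_interp M b) =
    decode_binary (binary_interp N) k b x y
}.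

Lemma decodes_to_decode (N : structure tau') k n (g : 'I_n -> N) (g' : N -> 'I_n) :
  cancel g g' -> cancel g' g ->
  decodes_to k (M := hardwired_pair (decode (binary_interp N) k g))
    (fun x => unsplit (sum_mapl g' x)).
Proof.
move=> gK g'K; split => [|//|u x|b x y].
- exists (fun x => sum_mapl g (split x)) => x.
    by rewrite unsplitK (sum_mapl_can g'K).
  by rewrite (sum_mapl_can gK) splitK.
- by rewrite ffunE inE unsplitK (sum_mapl_can g'K).
- by rewrite ffunE inE !unsplitK !(sum_mapl_can g'K).
Qed.

(** The isomorphism of the binary structures is extended by the identity on constants, then
    transported along [h] and [h']. *)
Lemma decodes_to_iso (N N' : structure tau') k (M M' : structure tau)
    (h : N + 'I_l -> M) (h' : N' + 'I_l -> M') :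
  decodes_to k h -> decodes_to k h' -> isomorphic N N' -> isomorphic M M'.
Proof.
case=> -[hi hK hiK] hc hu hb [[hi' hK' hiK'] hc' hu' hb'].
case=> f [[fi fK fiK] _ _ fb].
have dU u x : decode_unary (binary_interp N') k u (sum_mapl f x)
            = decode_unary (binary_interp N) k u x by case: x => //= y; rewrite fb.
have dB b x y : decode_binary (binary_interp N') k b (sum_mapl f x) (sum_mapl f y)
            = decode_binary (binary_interp N) k b x y.
  by case: x y => [x|c] [y|d] //=; rewrite fb.
exists (fun x => h' (sum_mapl f (hi x))); split => [|c|u x|b x y].
- exists (fun x => h (sum_mapl fi (hi' x))) => x.
    by rewrite hK' (sum_mapl_can fK) hiK.
  by rewrite hK (sum_mapl_can fiK) hiK'.
- by rewrite -hc hK /= hc'.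
- by rewrite hu' dU -hu hiK.
- by rewrite hb' dB -hb !hiK.
Qed.

Lemma well_coded_iso (N N' : structure tau') :
  isomorphic N N' -> well_coded (binary_interp N) -> well_coded (binary_interp N').
Proof.
case=> f [[fi fK fiK] _ _ fb] /andP[/forallP R0 /forallP diag].
apply/andP; split; [apply/forallP => j|apply/forallP => s].
  apply/eqP/setP => -[x y]; rewrite inE -(fiK x) -(fiK y) fb.
  by rewrite (eqP (R0 j)) inE.
apply/forallP => x; apply/forallP => y; rewrite -(fiK x) -(fiK y) fb.
apply/implyP => Rxy; move/forallP/(_ (fi x))/forallP/(_ (fi y)): (diag s).
by rewrite Rxy => /eqP ->.
Qed.

(** * Encoding as the inverse of decoding *)

Section Encoding.

Variables (n : nat) (T : finType) (g : 'I_n -> T) (g' : T -> 'I_n).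
Hypotheses (gK : cancel g g') (g'K : cancel g' g).

Variable UR : {ffun 'I_(nunary tau) -> {set 'I_(n + l)}} *
              {ffun 'I_(nbinary tau) -> {set 'I_(n + l) * 'I_(n + l)}}.

Definition type_of_consts : const_type :=
  ([ffun u => [set c | rshift n c \in UR.1 u]],
   [ffun b => [set z | (rshift n z.1, rshift n z.2) \in UR.2 b]]).

Definition encode_unary (s : unary_sym) (x : T) : bool :=
  match s with
  | inl u => lshift l (g' x) \in UR.1 u
  | inr (inl (b, c)) => (lshift l (g' x), rshift n c) \in UR.2 b
  | inr (inr (b, c)) => (rshift n c, lshift l (g' x)) \in UR.2 b
  end.

Definition encode : relations T := [ffun j =>
  match split j with
  | inl _ => set0
  | inr i =>
    match enum_val i with
    | inl b => [set z | (lshift l (g' z.1), lshift l (g' z.2)) \in UR.2 b]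
    | inr s => [set z | (z.1 == z.2) && encode_unary s z.1]
    end
  end].

Lemma encode_code s : encode (code s) =
  match s with
  | inl b => [set z | (lshift l (g' z.1), lshift l (g' z.2)) \in UR.2 b]
  | inr s => [set z | (z.1 == z.2) && encode_unary s z.1]
  end.
Proof. by rewrite ffunE (unsplitK (inr _)) enum_rankK. Qed.

Lemma well_coded_encode : well_coded encode.
Proof.
apply/andP; split; [apply/forallP => j|apply/forallP => s].
  by rewrite ffunE (unsplitK (inl _)).
apply/forallP => x; apply/forallP => y; apply/implyP.
by rewrite encode_code inE => /andP[].
Qed.

Lemma encodeK : decode encode type_of_consts g = UR.
Proof.
rewrite [RHS]surjective_pairing /decode; congr pair; apply/ffunP => s.
  apply/setP => x; rewrite ffunE inE -{2}(splitK x).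
  by case: (split x) => y /=; rewrite ?encode_code ?ffunE ?inE /= ?eqxx ?gK.
apply/setP => -[x y]; rewrite ffunE inE /= -{2}(splitK x) -{2}(splitK y).
by case: (split x) (split y) => [x'|c] [y'|d] /=;
  rewrite ?encode_code ?ffunE ?inE /= ?eqxx ?gK.
Qed.

End Encoding.

Lemma type_of_consts_decode (T : finType) (R : relations T) k n (g : 'I_n -> T) :
  type_of_consts (decode R k g) = k.
Proof.
case: k => kU kR; rewrite /type_of_consts /decode /=; congr pair; apply/ffunP => s;
  apply/setP => z; rewrite !ffunE !inE /= ?ffunE ?inE /=;
  by rewrite ?(unsplitK (inr _)) //; case: z.
Qed.

Lemma decodeK (T : finType) (R : relations T) k n (g : 'I_n -> T) (g' : T -> 'I_n) :
  cancel g' g -> well_coded R -> encode g' (decode R k g) = R.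
Proof.
move=> g'K /andP[/forallP R0 /forallP diag]; apply/ffunP => j.
rewrite -(splitK j); case: (split j) => i /=.
  by rewrite ffunE (unsplitK (inl _)) (eqP (R0 i)).
have -> : rshift #|const_type| i = code (enum_val i) by rewrite /code enum_valK.
rewrite encode_code; case: (enum_val i) => [b|s]; apply/setP => -[x y]; rewrite inE /=.
  by rewrite ffunE inE /= !(unsplitK (inl _)) /= !g'K.
(* The diagonal condition reduces the comparison to the pairs [(x, x)], which are the only ones that
   decoding retains. *)
have -> : ((x, y) \in R (code (inr s))) = (x == y) && ((x, x) \in R (code (inr s))).
  have [->|nxy] := eqVneq x y => //=; apply/negP => Rxy.
  by move/forallP/(_ x)/forallP/(_ y): (diag s); rewrite Rxy (negPf nxy).
congr (_ && _).
by case: s {diag} => [u|[[b c]|[b c]]] /=; rewrite ffunE inE /=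
  ?(unsplitK (inl _)) ?(unsplitK (inr _)) /= ?g'K.
Qed.

(** * Counting the structures of each constant type *)

Lemma decode_cast (C : class tau) (T : finType) (R : relations T) k m n
    (g : 'I_m -> T) (g' : 'I_n -> T) :
  m = n -> (forall i j, val i = val j -> g i = g' j) ->
  C (hardwired_pair (decode R k g)) <-> C (hardwired_pair (decode R k g')).
Proof.
move=> mn; case: n / mn g' => g' gg'.
by have -> : g' = g by apply: funext => i; rewrite -(gg' i i).
Qed.

(** As [C] may fail to be closed under isomorphism, one enumeration of the universe is fixed; on
    ordinals [enum_val] is the natural order, so the hard-wired count is exact. *)
Definition reduct_class (C : class tau) (k : const_type) : class tau' :=
  fun N => well_coded (binary_interp N) /\
    C (hardwired_pair (decode (binary_interp N) k (@enum_val N predT))).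

(** For fixed [k], decoding is a bijection from the well-coded binary structures in the reduct class
    onto the structures in [C] of constant type [k]. *)
Lemma card_type_class (C : class tau) k n :
  #|[set UR | `[< C (hardwired_pair (n := n) UR) >] & type_of_consts UR == k]|
  = Sp (reduct_class C k) n.
Proof.
pose g := cast_ord (esym (addn0 n)); pose g' := cast_ord (addn0 n).
have gK : cancel g g' by move=> i; apply: val_inj.
have g'K : cancel g' g by move=> i; apply: val_inj.
pose A := [set UR' : {ffun 'I_0 -> {set 'I_(n + 0)}} * relations 'I_(n + 0) |
  `[< reduct_class C k (@hardwired tau' n UR'.1 UR'.2) >]].
have memA UR' : (UR' \in A) =
    well_coded UR'.2 && `[< C (hardwired_pair (decode UR'.2 k g)) >].
  rewrite inE; have cast : C (hardwired_pair (decode UR'.2 k (@enum_val _ predT)))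
      <-> C (hardwired_pair (decode UR'.2 k g)).
    (* The cardinal of ['I_(n + 0)] is only provably equal to [n], so the enumeration and the cast
       [g] are compared through their values. *)
    apply: decode_cast => [|i j ij]; first by rewrite card_ord addn0.
    by apply: val_inj; rewrite enum_val_ord /= ij.
  apply/asboolP/andP => [[wR /cast CR]|[wR /asboolP/cast CR]]; split => //.
  exact/asboolP.
rewrite -[RHS]/#|A|.
have dec_inj : {in A &, injective (fun UR' => decode UR'.2 k g)}.
  move=> [U1 R1] [U2 R2]; rewrite !memA /= => /andP[w1 _] /andP[w2 _] eqd.
  congr pair; first by apply/ffunP => -[].
  by rewrite -(decodeK k g'K w1) eqd decodeK.
rewrite -(card_in_imset dec_inj); apply: eq_card => UR; rewrite inE.
apply/andP/imsetP => [[CUR /eqP tUR]|[[U' R']]].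
  exists ([ffun=> set0], encode g' UR).
    by rewrite memA /= well_coded_encode -tUR encodeK.
  by rewrite -tUR encodeK.
by rewrite memA => /andP[_ CR] ->; rewrite type_of_consts_decode.
Qed.

Lemma Sp_reduct (C : class tau) n :
  Sp C n = \sum_(k : const_type) Sp (reduct_class C k) n.
Proof.
rewrite /Sp -sum1_card (partition_big (@type_of_consts n) predT) //=.
apply: eq_bigr => k _; rewrite -[RHS]card_type_class -sum1_card.
by apply: eq_bigl => UR; rewrite !inE.
Qed.

(** The choice of enumeration is harmless here: decodings of isomorphic structures are isomorphic
    whatever enumerations are used. *)
Lemma reduct_class_iso (C : class tau) k :
  iso_closed C -> iso_closed (reduct_class C k).
Proof.
move=> Ciso N N' NN' [wN CN]; split; first exact: well_coded_iso NN' wN.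
apply: Ciso CN; apply: (decodes_to_iso _ _ NN').
  exact: (decodes_to_decode k (@enum_valK N) (@enum_rankK N)).
exact: (decodes_to_decode k (@enum_valK N') (@enum_rankK N')).
Qed.

(** * Translation of formulas into the binary vocabulary *)

Definition trans_term k k' (v : k.-tuple ('I_k' + 'I_l)) (t : term tau k) :
    'I_k' + 'I_l :=
  match t with Var i => tnth v i | Const c => inr c end.

Definition trans_unary (ct : const_type) k p u (t : 'I_k + 'I_l) :
    formula tau' k p :=
  match t with
  | inl i => @FBinary tau' k p (code_unary u) (Var tau' i) (Var tau' i)
  | inr c => FBool tau' k p (c \in ct.1 u)
  end.

Definition trans_binary (ct : const_type) k p b (t1 t2 : 'I_k + 'I_l) :
    formula tau' k p :=
  match t1, t2 with
  | inl i, inl j => @FBinary tau' k p (code (inl b)) (Var tau' i) (Var tau' j)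
  | inl i, inr c => @FBinary tau' k p (code_right b c) (Var tau' i) (Var tau' i)
  | inr c, inl j => @FBinary tau' k p (code_left b c) (Var tau' j) (Var tau' j)
  | inr c, inr d => FBool tau' k p ((c, d) \in ct.2 b)
  end.

(** Variables of the translation range over non-constant elements, so a mixed equation is false;
    distinct constants denote distinct elements. *)
Definition trans_eq k p (t1 t2 : 'I_k + 'I_l) : formula tau' k p :=
  match t1, t2 with
  | inl i, inl j => @FEq tau' k p (Var tau' i) (Var tau' j)
  | inr c, inr d => FBool tau' k p (c == d)
  | _, _ => FFalse tau' k p
  end.

Definition trans_mem k p (t : 'I_k + 'I_l) (X : 'I_p) (S : {set 'I_l}) :
    formula tau' k p :=
  match t with
  | inl i => @FMem tau' k p (Var tau' i) X
  | inr c => FBool tau' k p (c \in S)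
  end.

Definition bind_elt k k' (v : k.-tuple ('I_k' + 'I_l)) :
    k.+1.-tuple ('I_k'.+1 + 'I_l) :=
  cons_tuple (inl ord0) (map_tuple (sum_mapl (lift ord0)) v).

(* A variable of [phi] is sent by [v] either to a variable of the translation or
   to a fixed constant; [S] holds the constants belonging to each set variable,
   whose translation ranges over sets of non-constant elements only. *)
Fixpoint translate (ct : const_type) k p (phi : formula tau k p) :
    forall k', k.-tuple ('I_k' + 'I_l) -> p.-tuple {set 'I_l} ->
      formula tau' k' p :=
  match phi with
  | FFalse _ p => fun k' _ _ => FFalse tau' k' p
  | FEq _ p t1 t2 => fun k' v _ =>
      trans_eq p (trans_term v t1) (trans_term v t2)
  | FUnary _ p u t => fun k' v _ => trans_unary ct p u (trans_term v t)
  | FBinary _ p b t1 t2 => fun k' v _ =>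
      trans_binary ct p b (trans_term v t1) (trans_term v t2)
  | FMem _ p t X => fun k' v S => trans_mem (trans_term v t) X (tnth S X)
  | FNot _ _ f => fun k' v S => FNot (translate ct f v S)
  | FAnd _ _ f g => fun k' v S => FAnd (translate ct f v S) (translate ct g v S)
  | FOr _ _ f g => fun k' v S => FOr (translate ct f v S) (translate ct g v S)
  | FExists _ _ f => fun k' v S =>
      FOr (FExists (translate ct f (bind_elt v) S))
          (FBigOr (fun c => translate ct f (cons_tuple (inr c) v) S))
  | FForall _ _ f => fun k' v S =>
      FAnd (FForall (translate ct f (bind_elt v) S))
           (FBigAnd (fun c => translate ct f (cons_tuple (inr c) v) S))
  | FExistsSet _ _ f => fun k' v S =>
      FBigOr (fun A => FExistsSet (translate ct f v (cons_tuple A S)))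
  | FForallSet _ _ f => fun k' v S =>
      FBigAnd (fun A => FForallSet (translate ct f v (cons_tuple A S)))
  | FCount _ _ m r m_gt0 f => fun k' v S =>
      (* the disjunct [A] says that [A] is the set of constants satisfying [f];
         [r + #|A| * m.-1] is [r - #|A|] modulo [m] *)
      FBigOr (fun A : {set 'I_l} =>
        FAnd
          (FBigAnd (fun c =>
             let fc := translate ct f (cons_tuple (inr c) v) S in
             if c \in A then fc else FNot fc))
          (FCount (r + #|A| * m.-1) m_gt0 (translate ct f (bind_elt v) S)))
  end.

Lemma in_logic_translate L ct k p (phi : formula tau k p) :
  in_logic L phi -> forall k' (v : k.-tuple ('I_k' + 'I_l)) S,
  in_logic L (translate ct phi v S).
Proof.
elim: phi => {k p} //=.
- by move=> k p t1 t2 _ k' v S; case: trans_term => i; case: trans_term => j //=;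
    rewrite in_logic_FBool.
- by move=> k p u t _ k' v S; case: trans_term => i //=; rewrite in_logic_FBool.
- by move=> k p b t1 t2 _ k' v S; case: trans_term => i; case: trans_term => j //=;
    rewrite in_logic_FBool.
- by move=> k p t X L_set k' v S; case: trans_term => i //=; rewrite in_logic_FBool.
- by move=> k p f IHf g IHg /andP[Lf Lg] k' v S; rewrite IHf ?IHg.
- by move=> k p f IHf g IHg /andP[Lf Lg] k' v S; rewrite IHf ?IHg.
- move=> k p f IHf Lf k' v S; rewrite IHf //=.
  by apply: in_logic_FBigOr => c; apply: IHf.
- move=> k p f IHf Lf k' v S; rewrite IHf //=.
  by apply: in_logic_FBigAnd => c; apply: IHf.
- move=> k p f IHf /andP[L_set Lf] k' v S.
  by apply: in_logic_FBigOr => A /=; rewrite L_set IHf.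
- move=> k p f IHf /andP[L_set Lf] k' v S.
  by apply: in_logic_FBigAnd => A /=; rewrite L_set IHf.
- move=> k p m r m_gt0 f IHf /andP[L_cnt Lf] k' v S.
  apply: in_logic_FBigOr => A /=; rewrite L_cnt IHf // !andbT.
  by apply: in_logic_FBigAnd => c; case: ifP => _ /=; apply: IHf.
Qed.

(** * Correctness of the translation *)

Section Satisfaction.

Variables (N : structure tau') (ct : const_type) (M : structure tau).
Variable h : N + 'I_l -> M.
Hypothesis hM : decodes_to ct h.

Definition elt_env_match k k' (v : k.-tuple ('I_k' + 'I_l)) (e : k.-tuple M)
    (e' : k'.-tuple N) : Prop :=
  forall i, tnth e i = h (sum_mapl (tnth e') (tnth v i)).

Definition mem_split (A : {set N}) (S : {set 'I_l}) (x : N + 'I_l) : bool :=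
  match x with inl y => y \in A | inr c => c \in S end.

Definition set_env_match p (S : p.-tuple {set 'I_l}) (s : p.-tuple {set M})
    (s' : p.-tuple {set N}) : Prop :=
  forall X x, (h x \in tnth s X) = mem_split (tnth s' X) (tnth S X) x.

Lemma elt_env_match_inl k k' (v : k.-tuple ('I_k' + 'I_l)) e e' y :
  elt_env_match v e e' ->
  elt_env_match (bind_elt v) (cons_tuple (h (inl y)) e) (cons_tuple y e').
Proof.
move=> ve i; case: (unliftP ord0 i) => [j|] ->; last by rewrite !tnth0.
rewrite !tnthS ve tnth_map; case: (tnth v j) => //= j'.
by rewrite tnthS.
Qed.

Lemma elt_env_match_inr k k' (v : k.-tuple ('I_k' + 'I_l)) e e' c :
  elt_env_match v e e' ->
  elt_env_match (cons_tuple (inr c) v) (cons_tuple (h (inr c)) e) e'.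
Proof.
by move=> ve i; case: (unliftP ord0 i) => [j|] ->; rewrite ?tnth0 ?tnthS.
Qed.

Lemma set_env_match_cons p (S : p.-tuple {set 'I_l}) s s' A B (X : {set M}) :
  set_env_match S s s' -> (forall x, (h x \in X) = mem_split A B x) ->
  set_env_match (cons_tuple B S) (cons_tuple X s) (cons_tuple A s').
Proof.
by move=> Ss XAB i x; case: (unliftP ord0 i) => [j|] ->; rewrite ?tnth0 ?tnthS.
Qed.

Lemma eval_trans_term k k' (v : k.-tuple ('I_k' + 'I_l)) e e' t :
  elt_env_match v e e' -> eval e t = h (sum_mapl (tnth e') (trans_term v t)).
Proof. by case: t => [i|c] ve //=; rewrite (decodes_const hM). Qed.

Lemma exists_decodes (P : pred M) :
  [exists x, P x] = [exists y, P (h (inl y))] || [exists c, P (h (inr c))].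
Proof.
have [hi hK hiK] := decodes_bij hM.
apply/existsP/orP => [[x]|[]/existsP[y Py]]; last 2 first.
- by exists (h (inl y)).
- by exists (h (inr y)).
rewrite -(hiK x); case: (hi x) => [y|c] Px; [left|right]; apply/existsP.
  by exists y.
by exists c.
Qed.

(** Through [h], a subset of [M] is the same as a subset of [N] together with a set of constants. *)
Lemma exists_set_decodes (P : pred {set M}) (Q : {set N} -> {set 'I_l} -> bool) :
  (forall (X : {set M}) A B, (forall x, (h x \in X) = mem_split A B x) -> Q A B = P X) ->
  [exists X, P X] = [exists B, exists A, Q A B].
Proof.
have [hi hK hiK] := decodes_bij hM; move=> QP.
apply/existsP/existsP => [[X PX]|[B /existsP[A QAB]]].
  exists [set c | h (inr c) \in X]; apply/existsP.
  exists [set y | h (inl y) \in X].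
  by rewrite (QP X) // => -[y|c] /=; rewrite inE.
exists [set x | mem_split A B (hi x)].
by rewrite -(QP _ A B) // => x; rewrite inE hK.
Qed.

Lemma card_decodes (P : pred M) :
  #|[set x | P x]| = #|[set y | P (h (inl y))]| + #|[set c | P (h (inr c))]|.
Proof.
rewrite -!sum1_card.
under eq_bigl do rewrite inE.
under [X in _ = X + _]eq_bigl do rewrite inE.
under [X in _ = _ + X]eq_bigl do rewrite inE.
by rewrite (reindex h) ?big_sumType //; apply: onW_bij; apply: decodes_bij hM.
Qed.

(** Induction on [phi] over all matching environments, since each quantifier extends them. The
    decomposition of [M] along [h] splits elements, sets and cardinals into a part in [N] and a part
    in the constants. *)
Lemma sat_translate k p (phi : formula tau k p) :
  forall k' (v : k.-tuple ('I_k' + 'I_l)) (S : p.-tuple {set 'I_l}) e e' s s',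
  elt_env_match v e e' -> set_env_match S s s' ->
  sat (translate ct phi v S) e' s' = sat phi e s.
Proof.
have h_inj := bij_inj (decodes_bij hM).
elim: phi => {k p} //=.
- move=> k p t1 t2 k' v S e e' s s' ve _; rewrite !(eval_trans_term _ ve).
  rewrite (inj_eq h_inj); case: trans_term => i; case: trans_term => j //=.
  by rewrite sat_FBool.
- move=> k p u t k' v S e e' s s' ve _; rewrite !(eval_trans_term _ ve).
  rewrite (decodes_unary hM); case: trans_term => i //=.
  by rewrite sat_FBool.
- move=> k p b t1 t2 k' v S e e' s s' ve _; rewrite !(eval_trans_term _ ve).
  rewrite (decodes_binary hM); case: trans_term => i; case: trans_term => j //=.
  by rewrite sat_FBool.
- move=> k p t X k' v S e e' s s' ve Ss; rewrite !(eval_trans_term _ ve) Ss.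
  by case: trans_term => i //=; rewrite sat_FBool.
- by move=> k p f IHf k' v S e e' s s' ve Ss; rewrite (IHf _ v S e e' s s').
- move=> k p f IHf g IHg k' v S e e' s s' ve Ss.
  by rewrite (IHf _ v S e e' s s') // (IHg _ v S e e' s s').
- move=> k p f IHf g IHg k' v S e e' s s' ve Ss.
  by rewrite (IHf _ v S e e' s s') // (IHg _ v S e e' s s').
- move=> k p f IHf k' v S e e' s s' ve Ss.
  rewrite sat_FBigOr exists_decodes; congr (_ || _); apply: eq_existsb => x /=.
    by apply: IHf => //; apply: elt_env_match_inl.
  by apply: IHf => //; apply: elt_env_match_inr.
- move=> k p f IHf k' v S e e' s s' ve Ss.
  (* Negating both sides reduces the universal case to the splitting of an existential
     quantifier. *)
  rewrite sat_FBigAnd; apply: negb_inj; rewrite negb_and !negb_forall.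
  rewrite (exists_decodes (fun x => ~~ sat f (cons_tuple x e) s)).
  congr (_ || _); apply: eq_existsb => x /=; congr (~~ _).
    by apply: IHf => //; apply: elt_env_match_inl.
  by apply: IHf => //; apply: elt_env_match_inr.
- move=> k p f IHf k' v S e e' s s' ve Ss; rewrite sat_FBigOr /=.
  apply/esym; apply: (exists_set_decodes (P := fun X => sat f e (cons_tuple X s))
    (Q := fun A B => sat (translate ct f v (cons_tuple B S)) e' (cons_tuple A s'))).
  by move=> X A B XAB; apply: IHf => //; apply: set_env_match_cons.
- move=> k p f IHf k' v S e e' s s' ve Ss; rewrite sat_FBigAnd /=.
  apply: negb_inj; rewrite !negb_forall.
  under eq_existsb do rewrite negb_forall.
  apply/esym; apply: (exists_set_decodes (P := fun X => ~~ sat f e (cons_tuple X s))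
    (Q := fun A B =>
      ~~ sat (translate ct f v (cons_tuple B S)) e' (cons_tuple A s'))).
  move=> X A B XAB; congr (~~ _).
  by apply: IHf => //; apply: set_env_match_cons.
- move=> k p m r m_gt0 f IHf k' v S e e' s s' ve Ss; rewrite sat_FBigOr /=.
  (* The set of constants that really satisfy [f]: only the disjunct indexed by [A0] can hold, and
     there the shifted residue compensates for the [#|A0|] elements not counted in [N]. *)
  pose A0 := [set c | sat f (cons_tuple (h (inr c)) e) s].
  have IHc c : sat (translate ct f (cons_tuple (inr c) v) S) e' s' = (c \in A0).
    by rewrite inE; apply: IHf => //; apply: elt_env_match_inr.
  rewrite card_decodes -/A0 -modn_shift //.
  have -> : [set y | sat f (cons_tuple (h (inl y)) e) s]
      = [set y | sat (translate ct f (bind_elt v) S) (cons_tuple y e') s'].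
    apply/setP => y; rewrite !inE; apply/esym.
    by apply: IHf => //; apply: elt_env_match_inl.
  have satA (A : {set 'I_l}) : sat (FBigAnd (fun c =>
      let fc := translate ct f (cons_tuple (inr c) v) S in
      if c \in A then fc else FNot fc)) e' s' = (A == A0).
    rewrite sat_FBigAnd; apply/forallP/eqP => [AA0|-> c].
      apply/setP => c; have := AA0 c.
      by case: (c \in A) => /=; rewrite IHc // => /negPf.
    by case: (boolP (c \in A0)) => cA /=; rewrite IHc.
  apply/existsP/idP => [[A]|cnt]; last by exists A0; rewrite satA eqxx.
  by rewrite satA => /andP[/eqP ->].
Qed.

End Satisfaction.

(** * Definability of the reduct classes *)

Definition well_coded_sentence : sentence tau' :=
  let x := Var tau' (ord0 : 'I_2) in
  let y := Var tau' (ord_max : 'I_2) in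
  FAnd
    (FBigAnd (fun j : 'I_#|const_type| =>
       FForall (FForall (FNot (@FBinary tau' 2 0 (lshift #|sym| j) x y)))))
    (FBigAnd (fun s : unary_sym =>
       FForall (FForall
         (FOr (FNot (@FBinary tau' 2 0 (code (inr s)) x y))
              (@FEq tau' 2 0 x y))))).

Lemma in_logic_well_coded L : in_logic L well_coded_sentence.
Proof. by rewrite /= !in_logic_FBigAnd. Qed.

Lemma models_well_coded (N : structure tau') :
  models N well_coded_sentence = well_coded (binary_interp N).
Proof.
have tnth2 (x y : N) : tnth (cons_tuple x (cons_tuple y (nil_tuple N))) ord_max = y.
  by [].
rewrite /models /= !sat_FBigAnd; congr (_ && _).
  apply: eq_forallb => j /=; apply/forallP/eqP => [R0|R0 x].
    apply/setP => -[x y]; rewrite inE; apply/negbTE.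
    (* The outer quantifier binds index 1, which is [y], hence the instantiation at [y] before
       [x]. *)
    by have /forallP/(_ x) := R0 y.
  by apply/forallP => y; rewrite R0 inE.
apply: eq_forallb => s /=; apply/forallP/forallP => diag x; apply/forallP => y;
  by have /forallP/(_ x) := diag y; rewrite implybE.
Qed.

Lemma definable_reduct L (C : class tau) k :
  definable L C -> definable L (reduct_class C k).
Proof.
case=> phi Lphi Cphi.
pose psi := translate k phi (nil_tuple ('I_0 + 'I_l)) (nil_tuple {set 'I_l}).
exists (FAnd well_coded_sentence psi) => [|N].
  by apply/andP; split; [apply: in_logic_well_coded|apply: in_logic_translate].
have -> : models N (FAnd well_coded_sentence psi) =
          models N well_coded_sentence && models N psi by [].
rewrite models_well_coded /reduct_class.
have hM := decodes_to_decode k (@enum_valK N) (@enum_rankK N).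
have -> : models N psi =
          models (hardwired_pair (decode (binary_interp N) k (@enum_val N predT))) phi.
  (* For a sentence the environments are empty, so both matching conditions quantify over indices in
     ['I_0]. *)
  by apply: (sat_translate hM) => -[].
by rewrite Cphi; split => [[-> ->]|/andP].
Qed.

End Reduction.

Theorem theorem6p1 (tau : vocabulary) :
  exists r : nat,
  forall C : class tau,
  exists Cs : 'I_r -> class (binary_vocabulary r),
    [/\ forall n : nat, Sp C n = \sum_(i < r) Sp (Cs i) n,
        forall L : logic, definable L C -> forall i : 'I_r, definable L (Cs i)
      & iso_closed C -> forall i : 'I_r, iso_closed (Cs i)].
Proof.
exists (nsym tau) => C.
(* The first [#|const_type|] indices carry the reduct classes. The others carry the empty class,
   which contributes zero to the sum and is defined by [FFalse] in every logic. *)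
exists (fun i => match split i with
                 | inl j => reduct_class C (enum_val j)
                 | inr _ => fun _ => False
                 end); split => [n|L LC i|Ciso i].
- rewrite Sp_reduct big_split_ord /= [X in _ = _ + X]big1 => [|j _].
    rewrite addn0 big_enum_val /=; apply: eq_bigr => j _.
    by rewrite (unsplitK (inl _)).
  rewrite (unsplitK (inr _)); apply: eq_card0 => UR; rewrite inE.
  by apply/asboolP.
- case: split => j; first exact: definable_reduct.
  by exists (FFalse _ 0 0).
- by case: split => j; first exact: reduct_class_iso.
Qed.
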